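(* Let $n,k,s\in\mathbb{N}$ and $0<\varepsilon\le 1$. Suppose that $G$ is an $n$-vertex $(\varepsilon,s)$-expander and $s\ge 2^{12}\varepsilon^{-1}k^2\log^4 n$. Then there are edge-disjoint graphs $G_1,\ldots,G_k$ such that $E(G)=\bigcup_{i\in[k]}E(G_i)$ and, for each $i\in[k]$, $G_i$ is an $\left(\frac{\varepsilon}{4},\frac{\sqrt{s\varepsilon}}{8k\log n}\right)$-expander with vertex set $V(G)$.
   Context: Graphs are finite and simple; logarithms have base two and $\log^k n=(\log n)^k$; $[k]=\{1,\ldots,k\}$. For a graph $G$ and $F\subseteq E(G)$, $G-F$ is $G$ with the edges of $F$ deleted. $N_G(U)$ is the set of vertices in $V(G)\setminus U$ with a neighbour in $U$. For real $s\ge 0$, an $n$-vertex graph $G$ is an $(\varepsilon,s)$-expander if, for every $U\subseteq V(G)$ and $F\subseteq E(G)$ with $1\le|U|\le\frac23 n$ and $|F|\le s|U|$, we have $|N_{G-F}(U)|\ge \frac{\varepsilon|U|}{\log^2 n}$. (For $n=1$ this condition is vacuous, whatever the parameters.) *)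

(* Defs.v *)
From HB Require Import structures.
From mathcomp Require Import all_boot all_order all_algebra.
From mathcomp Require Import reals exp.

Set Implicit Arguments.
Unset Strict Implicit.
Unset Printing Implicit Defensive.

Import Order.TTheory GRing.Theory Num.Theory.
Local Open Scope ring_scope.

(* A finite simple graph with vertex set all of V; an edge is the
   two-element set of its ends. *)
Record sgraph (V : finType) := SGraph {
  edges : {set {set V}};
  edges_card2 : forall e, e \in edges -> #|e| = 2%N
}.

Section Graph.
Variables (V : finType) (G : sgraph V).

Fact del_edges_card2 (F : {set {set V}}) e :
  e \in edges G :\: F -> #|e| = 2%N.
Proof. by case/setDP => eG _; exact: edges_card2 eG. Qed.

Definition del_edges (F : {set {set V}}) : sgraph V :=
  SGraph (@del_edges_card2 F).

Definition adj (u v : V) : bool := [set u; v] \in edges G.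

Definition nbhd (U : {set V}) : {set V} :=
  [set v | (v \notin U) && [exists u in U, adj u v]].

End Graph.

Definition log2 (R : realType) (x : R) : R := ln x / ln 2.

(* When #|V| <= 1 no U satisfies the cardinality constraints, so the junk
   value of the division by log2 1 = 0 is never used. *)
Definition expander (R : realType) (V : finType) (eps s : R) (G : sgraph V) :
    Prop :=
  forall (U : {set V}) (F : {set {set V}}),
    (1 <= #|U|)%N ->
    #|U|%:R <= 2 / 3 * #|V|%:R :> R ->
    F \subset edges G ->
    #|F|%:R <= s * #|U|%:R ->
    #|nbhd (del_edges G F) U|%:R >= eps * #|U|%:R / log2 #|V|%:R ^+ 2.

(* Main.v *)
Require Import Defs.
From HB Require Import structures.
From mathcomp Require Import all_boot all_order all_algebra.
From mathcomp Require Import reals exp.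
From mathcomp Require Import sequences ring lra zify.

Set Implicit Arguments.
Unset Strict Implicit.
Unset Printing Implicit Defensive.

Import Order.TTheory GRing.Theory Num.Theory.
Local Open Scope ring_scope.

(** Colour the edges uniformly at random with k colours. Write L = log n,
S = sqrt (s eps) and d = 4 L S / eps, and fix U; let Y be the set of vertices
outside U with at least d neighbours in U. By a Chernoff bound, some colouring
gives each colour more than 1/(8k) of the edges of every large cut between U
and Z, or between U and the complement of U :|: Z, with #|Z| <= #|U|; the
exponential bound beats the at most n^(2|U|) choices of (U, Z).

If #|Y| >= eps |U| / (2 L^2) but few vertices of Y are reached in colour i
after deleting F, then all the colour-i edges from U to at least
eps |U| / (4 L^2) vertices of Y lie in F, which is too small to contain them.
Otherwise expansion of G shows that more than s |U| edges leave U towards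
vertices of degree less than d into U; the colour-i ones not in F are still so
many that they reach many vertices. *)


(** * Chernoff bound for random colourings *)

(** The generating function of the number of elements of [A] coloured [i], scaled by the number of
    colourings. Colours of different elements are independent, so the sum of products is a product
    of sums. *)
Lemma sum_ffun_expr (R : fieldType) (T : finType) (k : nat) (i : 'I_k)
    (A : {set T}) (x : R) :
  k%:R != 0 :> R ->
  \sum_(c : {ffun T -> 'I_k}) x ^+ #|[set e in A | c e == i]| =
  k%:R ^+ #|T| * (1 - (1 - x) / k%:R) ^+ #|A|.
Proof.
move=> k0.
have sum_i e : \sum_(j < k) (if (e \in A) && (j == i) then x else 1) =
    k%:R * (if e \in A then 1 - (1 - x) / k%:R else 1).
  case: (e \in A) => /=; last first.
    by rewrite mulr1 sumr_const card_ord.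
  rewrite (bigD1 i) //= eqxx (eq_bigr (fun=> 1)); last first.
    by move=> j /negbTE->.
  have := cardC1 i; rewrite card_ord sumr_const => ->.
  have kpos : (0 < k)%N by apply: leq_trans (ltn_ord i).
  by rewrite -(prednK kpos) /= in k0 *; rewrite -natr1 in k0 *; field.
transitivity (\sum_(c : {ffun T -> 'I_k})
    \prod_e (if (e \in A) && (c e == i) then x else 1)).
  apply: eq_bigr => c _; rewrite -big_mkcond /= prodr_const.
  by congr (_ ^+ _); apply: eq_card => e; rewrite !inE.
rewrite -(bigA_distr_bigA (fun e j => if (e \in A) && (j == i) then x else 1)).
rewrite (eq_bigr _ (fun e _ => sum_i e)) big_split /= prodr_const.
by rewrite -big_mkcond /= prodr_const.
Qed.

(** First-moment argument on the exponential weights of a lower-tail Chernoff bound: each bad event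
    alone weighs at least 1, so a colouring of total weight below 1 avoids them all. *)
Lemma exists_balanced_colouring (R : realType) (T I : finType) (P : pred I)
    (A : I -> {set T}) (k : nat) :
  (0 < k)%N ->
  \sum_(t | P t) k%:R * expR (- (3 / 8) * (#|A t|%:R / k%:R)) < 1 :> R ->
  exists c : {ffun T -> 'I_k}, forall t, P t -> forall i,
    #|A t|%:R / k%:R < 8 * #|[set e in A t | c e == i]|%:R :> R.
Proof.
move=> k0 sum_lt1.
have k0R : 0 < k%:R :> R by rewrite ltr0n.
pose g t c i : R := expR (#|A t|%:R / k%:R / 8)
   * (1 / 2) ^+ #|[set e in A t | (c : {ffun T -> 'I_k}) e == i]|.
have g_ge0 t c i : 0 <= g t c i.
  by rewrite mulr_ge0 ?expR_ge0// exprn_ge0// divr_ge0.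
pose w c := \sum_(t | P t) \sum_(i < k) g t c i.
have sum_w : \sum_c w c < k%:R ^+ #|T|.
  rewrite exchange_big /= -[ltRHS]mulr1.
  apply: le_lt_trans (_ : k%:R ^+ #|T| *
    \sum_(t | P t) k%:R * expR (- (3 / 8) * (#|A t|%:R / k%:R)) < _); last first.
    by rewrite ltr_pM2l// exprn_gt0.
  rewrite mulr_sumr; apply: ler_sum => t _.
  rewrite exchange_big /= mulrCA -[in leRHS](card_ord k) [leRHS]mulr_natl -sumr_const.
  apply: ler_sum => i _; rewrite /g -mulr_sumr sum_ffun_expr; last exact: lt0r_neq0.
  rewrite card_ord mulrCA ler_pM2l ?exprn_gt0//.
  (* The 1/8 comes from the target density, and 1/2 from [1 - 1/(2k) <= exp(-1/(2k))]; their
     difference is 3/8. *)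
  have -> : - (3 / 8) * (#|A t|%:R / k%:R) =
     #|A t|%:R / k%:R / 8 + #|A t|%:R * (- (2 * k%:R)^-1) :> R.
    by field; rewrite lt0r_neq0.
  rewrite expRD ler_pM2l ?expR_gt0// expRM_natl lerXn2r ?nnegrE ?expR_ge0//.
    rewrite subr_ge0 ler_pdivrMr// mul1r; have : 1 <= k%:R :> R by rewrite ler1n.
    by lra.
  have -> : 1 - (1 - 1 / 2) / k%:R = 1 + (- (2 * k%:R)^-1) :> R.
    by field; rewrite lt0r_neq0.
  exact: expR_ge1Dx.
have [c wc1] : exists c, w c < 1.
  apply/existsP; apply: contraLR sum_w; rewrite negb_exists -leNgt => /forallP w1.
  have -> : k%:R ^+ #|T| = \sum_(c : {ffun T -> 'I_k}) 1 :> R.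
    by rewrite sumr_const card_ffun card_ord natrX.
  by apply: ler_sum => c _; rewrite leNgt.
exists c => t Pt i.
have : g t c i < 1.
  apply: le_lt_trans wc1; rewrite /w (bigD1 t)//= (bigD1 i)//= -addrA lerDl.
  by rewrite addr_ge0 ?sumr_ge0// => t' _; rewrite sumr_ge0.
rewrite /g ltNge => /negP gt1; rewrite ltNge; apply/negP => le8; apply: gt1.
set m := #|[set _ in _ | _]| in le8 *.
(* As [1/2 >= exp(-1)], having [8m] at most [#|A t| / k] makes the weight at least
   [exp(#|A t|/(8k) - m) >= 1]. *)
have half : expR (- 1) <= 1 / 2 :> R.
  rewrite expRN -[1 / 2]invf_div lef_pV2 ?posrE ?expR_gt0 ?divr1//.
  by have := expR_ge1Dx (1 : R); lra.
have : expR (- 1) ^+ m <= (1 / 2) ^+ m :> R.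
  by rewrite lerXn2r ?nnegrE ?expR_ge0// divr_ge0.
rewrite -expRM_natl => le1.
apply: le_trans (ler_wpM2l (expR_ge0 _) le1).
rewrite -expRD -[leLHS]expR0 ler_expR; lra.
Qed.

(** * Estimates for sums over vertex sets *)

Lemma sum_expr_card (R : comPzRingType) (T : finType) (y : R) :
  \sum_(U : {set T}) y ^+ #|U| = (1 + y) ^+ #|T|.
Proof.
have := @bigA_distr _ 0 1 *%R +%R T (fun=> y) (fun=> 1).
rewrite prodr_const addrC => ->; apply: eq_bigr => U _.
by rewrite -big_mkcond /= prodr_const.
Qed.

Lemma expr1D_le (R : realFieldType) (n : nat) (y : R) :
  0 <= y -> n%:R * y <= 1 / 2 -> (1 + y) ^+ n <= 1 + 2 * (n%:R * y).
Proof.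
move=> y0; elim: n => [|n IH] ny; first by rewrite expr0; lra.
rewrite -natr1 in ny *; have {}IH := IH ltac:(lra).
(* The cross term [2ny^2] is at most [y] because [ny <= 1/2]. *)
rewrite exprS; apply: le_trans (ler_wpM2l _ IH) _; first lra.
nra.
Qed.


(** * Edges between a vertex set and its outside *)

Section Cut.
Variables (V : finType) (G : sgraph V).
Implicit Types (U Z : {set V}) (v : V) (e : {set V}).

(** For [v] outside [U] its size is the degree of [v] into [U]. Keeping edges rather than neighbours
    allows comparison with [F] and with colour classes. *)
Definition star U v : {set {set V}} :=
  [set e in edges G | (v \in e) && ~~ [disjoint e & U]].

Definition cut_edges U Z : {set {set V}} := \bigcup_(z in Z) star U z.

Lemma cut_sub U Z : cut_edges U Z \subset edges G.
Proof. by apply/bigcupsP => z _; apply/subsetP => e; rewrite inE => /andP[]. Qed.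

Lemma in_nbhd U v : (v \in nbhd G U) = (v \notin U) && (star U v != set0).
Proof.
rewrite inE; apply: andb_id2l => vU; apply/existsP/set0Pn => -[].
  move=> u /andP[uU uv]; exists [set u; v]; rewrite inE [_ \in edges G]uv !inE eqxx orbT /=.
  by apply/pred0Pn; exists u; rewrite /= !inE eqxx.
move=> e; rewrite inE => /and3P[eG ve /pred0Pn[u /= /andP[ue uU]]].
exists u; rewrite uU /adj.
have uv : u != v by apply: contraNneq vU => <-.
suff -> : [set u; v] = e by [].
by apply/eqP; rewrite eqEcard (edges_card2 eG) cards2 uv subUset !sub1set ue ve.
Qed.

(** The stars are disjoint: an edge in two of them would contain two vertices of [Z] and one of [U],
    three in all. *)
Lemma card_cut U Z : [disjoint Z & U] ->
  #|cut_edges U Z| = (\sum_(z in Z) #|star U z|)%N.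
Proof.
move=> ZU.
have starI z z' e : z \in Z -> z' \in Z -> e \in star U z -> e \in star U z' ->
    z = z'.
  move=> zZ z'Z; rewrite !inE => /and3P[eG ze /pred0Pn[u /= /andP[ue uU]]].
  move=> /and3P[_ z'e _]; apply/eqP; apply: contraTT isT => zz'.
  have uZ x : x \in Z -> x != u.
    by move=> xZ; apply: contraTneq uU => <-; rewrite (disjointFr ZU).
  have : z |: [set z'; u] \subset e by rewrite !subUset !sub1set ze z'e ue.
  move/subset_leq_card; rewrite (edges_card2 eG) cardsU1 cards2 !inE.
  by rewrite negb_or zz' !uZ.
rewrite /cut_edges -big_enum -[RHS]big_enum /=.
have : {subset enum Z <= Z} by move=> z; rewrite mem_enum.
elim: (enum Z) (enum_uniq Z) => [|z r IH] /= rU rZ; first by rewrite !big_nil cards0.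
have [zr {}rU] := andP rU.
rewrite !big_cons cardsU -IH//; last by move=> x xr; rewrite rZ ?inE ?xr ?orbT.
rewrite (_ : _ :&: _ = set0) ?cards0 ?subn0//; apply/setP => e; rewrite !in_setI in_set0.
apply/negP => /andP[ez]; rewrite bigcup_seq => /bigcupP[z' z'r ez'].
case/negP: zr; rewrite (starI _ _ _ _ _ ez ez') ?rZ ?inE ?eqxx//.
by rewrite z'r orbT.
Qed.

Lemma card_cut_le U Z : (#|cut_edges U Z| <= \sum_(z in Z) #|star U z|)%N.
Proof.
rewrite /cut_edges; elim/big_rec2: _ => [|z m S _ IH]; first by rewrite cards0.
by apply: leq_trans (leq_card_setU _ _) _; rewrite leq_add2l.
Qed.

End Cut.

(** * Expansion of a subgraph that meets large cuts proportionally *)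

Lemma exists_subset_card (T : finType) (A : {set T}) (m : nat) :
  (m <= #|A|)%N -> exists2 B : {set T}, B \subset A & #|B| = m.
Proof.
move=> mA; have : (0 < #|[set B : {set T} | B \subset A & #|B| == m]|)%N.
  by rewrite cards_draws bin_gt0.
by case/card_gt0P => B; rewrite inE => /andP[BA /eqP]; exists B.
Qed.

(* For the application, m = eps |U| / (4 L^2), d = 4 L S / eps, sigma = s |U|,
   f = S |U| / (8 k L), and t = 64 k |U| L is the size from which cuts are
   balanced. *)
Lemma subgraph_expands (R : realFieldType) (V : finType) (G H : sgraph V)
    (U : {set V}) (F : {set {set V}}) (k sigma f d m t : R) :
  edges H \subset edges G ->
  (forall F0 : {set {set V}}, F0 \subset edges G -> #|F0|%:R <= sigma ->
    4 * m <= #|nbhd (del_edges G F0) U|%:R) ->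
  (forall Z : {set V}, (#|Z| <= #|U|)%N -> t <= #|cut_edges G U Z|%:R ->
    #|cut_edges G U Z|%:R / k < 8 * #|cut_edges G U Z :&: edges H|%:R) ->
  (forall Z : {set V}, (#|Z| <= #|U|)%N -> t <= #|cut_edges G U (~: U :\: Z)|%:R ->
    #|cut_edges G U (~: U :\: Z)|%:R / k < 8 * #|cut_edges G U (~: U :\: Z) :&: edges H|%:R) ->
  #|F|%:R <= f -> 0 < k -> 0 < d -> 0 < m -> 4 * m <= #|U|%:R ->
  t <= d * m -> 8 * k * f <= d * m -> t <= sigma ->
  8 * k * (d * m + f) <= sigma ->
  m <= #|nbhd (del_edges H F) U|%:R.
Proof.
move=> HG expG goodZ goodC Ff k0 d0 m0 mU tdm fdm tsig dmsig.
set N := nbhd _ U; rewrite leNgt; apply/negP => Nm.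
have starN e v : v \notin U -> v \notin N -> e \in star G U v -> e \in edges H ->
    e \in F.
  rewrite in_nbhd => -> /=; rewrite negbK => /eqP star0.
  rewrite inE => /and3P[_ ve eU] eH; apply: contraT => eF.
  have : e \in star (del_edges H F) U v by rewrite !inE eH eF ve eU.
  by rewrite star0 inE.
pose Y := [set v | (v \notin U) && (d <= #|star G U v|%:R)].
have [Ym|Ym] := lerP (2 * m) #|Y|%:R.
  (* [Y :\: N] has more than [2m - m] elements; if it exceeds [#|U|], cut it down to size
     [#|U| >= 4m]. *)
  have [Z [ZYN ZU Zm]] : exists Z : {set V}, [/\ Z \subset Y :\: N, (#|Z| <= #|U|)%N
      & m <= #|Z|%:R].
    have [YNU|/ltnW UYN] := leqP #|Y :\: N| #|U|.
      exists (Y :\: N); split=> //; move: Nm Ym.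
      rewrite -(cardsID N Y) natrD; have : #|Y :&: N|%:R <= #|N|%:R :> R.
        by rewrite ler_nat subset_leq_card ?subsetIr.
      lra.
    have [Z ZYN ZU] := exists_subset_card UYN.
    by exists Z; rewrite ZU; split=> //; lra.
  have ZP v : v \in Z -> [/\ v \notin U, v \notin N & d <= #|star G U v|%:R].
    by move/(subsetP ZYN); rewrite !inE => /andP[-> /andP[-> ->]].
  have dcut : d * m <= #|cut_edges G U Z|%:R.
    rewrite card_cut; last first.
      by apply/pred0P => v /=; apply/negP => /andP[/ZP[/negP]].
    rewrite natr_sum; apply: le_trans (_ : \sum_(z in Z) d <= _); last first.
      by apply: ler_sum => z /ZP[].
    by rewrite sumr_const -mulr_natr ler_pM2l.
  (* All edges of [H] in this cut lie in [F], so balance bounds the cut strictly by [8kf <= dm],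
     against [dcut]. *)
  have := goodZ Z ZU (le_trans tdm dcut).
  have : #|cut_edges G U Z :&: edges H|%:R <= #|F|%:R :> R.
    rewrite ler_nat; apply/subset_leq_card/subsetP => e.
    by rewrite inE => /andP[/bigcupP[v /ZP[vU vN _]]]; exact: starN.
  rewrite ltr_pdivrMr// => cF cutF.
  have : 8 * #|cut_edges G U Z :&: edges H|%:R * k <= 8 * f * k by rewrite ler_pM2r//; lra.
  lra.
set X := ~: U :\: Y.
(* A cut of at most [sigma] edges could be deleted in [G]; then [U] would have neighbours only in
   [Y], fewer than [2m] of them, against the guaranteed [4m]. *)
have [cutX|cutX] := lerP #|cut_edges G U X|%:R sigma.
  have := expG _ (cut_sub _ _ _) cutX.
  suff : #|nbhd (del_edges G (cut_edges G U X)) U|%:R <= #|Y|%:R :> R by lra.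
  rewrite ler_nat; apply/subset_leq_card/subsetP => v.
  rewrite in_nbhd => /andP[vU /set0Pn[e]]; rewrite in_set => /and3P[].
  rewrite /= in_setD => /andP[ecut eG] ve eU; apply: contraR ecut => vY.
  by apply/bigcupP; exists v; rewrite /X ?in_setD ?in_setC ?vY// inE eG ve.
have YU : (#|Y| <= #|U|)%N by rewrite -(ler_nat R); lra.
have := goodC Y YU (le_trans tsig (ltW cutX)).
(* An edge of [H] in the cut lies in [F] or has its outer end in [N], and vertices of [X] have
   degree below [d] into [U]. *)
have : #|cut_edges G U X :&: edges H|%:R <= f + d * #|N|%:R.
  apply: le_trans (_ : (#|F| + #|cut_edges G U (X :&: N)|)%:R <= _).
    rewrite ler_nat -(cardsID F) leq_add//; first by rewrite subset_leq_card ?subsetIr.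
    apply/subset_leq_card/subsetP => e; rewrite !inE => /and3P[eF /bigcupP[v vX ev] eH].
    apply/bigcupP; exists v => //; rewrite inE vX /=; apply: contraR eF => vN.
    by apply: starN ev eH => //; move: vX; rewrite !inE => /andP[].
  rewrite natrD lerD//; apply: le_trans (_ : (\sum_(z in X :&: N) #|star G U z|)%:R <= _).
    by rewrite ler_nat card_cut_le.
  rewrite natr_sum; apply: le_trans (_ : \sum_(z in X :&: N) d <= _).
    apply: ler_sum => z; rewrite in_setI in_setD in_setC inE.
    move=> /andP[/andP[+ zU] _]; rewrite zU /= -ltNge; exact: ltW.
  by rewrite sumr_const -[leLHS]mulr_natr ler_pM2l// ler_nat subset_leq_card ?subsetIr.
rewrite ltr_pdivrMr// => cF cutF.
have : 8 * #|cut_edges G U X :&: edges H|%:R * k <= 8 * (f + d * #|N|%:R) * k.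
  by rewrite ler_pM2r//; lra.
have : d * #|N|%:R < d * m by rewrite ltr_pM2l.
move/ltW; rewrite -(ler_pM2l k0); lra.
Qed.


(** * Union bound over pairs of vertex sets *)

(* The boolean selects one of the two cuts attached to a pair (U, Z). *)
Lemma sum_expR_pairs_lt1 (R : realType) (V : finType) (k : nat)
    (a : bool * ({set V} * {set V}) -> R) :
  (1 < #|V|)%N -> (k <= #|V| ^ 2)%N ->
  \sum_(t : bool * ({set V} * {set V}) | [&& t.2.1 != set0, (#|t.2.2| <= #|t.2.1|)%N
            & 64 * #|t.2.1|%:R * ln #|V|%:R <= a t])
    k%:R * expR (- (3 / 8) * a t) < 1.
Proof.
set n := #|V| => n1 kn.
have n0 : 0 < n%:R :> R by rewrite ltr0n; lia.
(* The exponent is [12 = (3/8) * 64 / 2]: each term is at most [k y^(2|U|)], hence at most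
   [k y^(|U|+|Z|)], which factors over [U] and [Z] once the size conditions are dropped. *)
pose y : R := (n%:R^-1) ^+ 12.
have n2 : 2 <= n%:R :> R by rewrite ler_nat.
have ninv0 : 0 < n%:R^-1 :> R by rewrite invr_gt0.
have ninv2 : n%:R^-1 <= 1 / 2 :> R.
  by rewrite -[1 / 2]invf_div lef_pV2 ?posrE ?divr1.
have y0 : 0 <= y by rewrite exprn_ge0//; lra.
have y1 : y <= 1 by rewrite exprn_ile1//; lra.
apply: le_lt_trans (_ : \sum_(t : bool * ({set V} * {set V}) | t.2.1 != set0)
   k%:R * (y ^+ #|t.2.1| * y ^+ #|t.2.2|) < _).
  rewrite [leRHS](bigID (fun t : bool * ({set V} * {set V}) =>
    (#|t.2.2| <= #|t.2.1|)%N && (64 * #|t.2.1|%:R * ln n%:R <= a t))) /=.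
  rewrite ler_wpDr//.
    by apply: sumr_ge0 => t _; rewrite mulr_ge0// mulr_ge0// exprn_ge0.
  apply: ler_sum => -[b [U Z]] /= /and3P[_ ZU lea]; apply: ler_wpM2l => //.
  apply: le_trans (_ : y ^+ #|U| * y ^+ #|U| <= _); last first.
    by apply: ler_wpM2l; [exact: exprn_ge0 | exact: ler_wiXn2l].
  rewrite -exprD /y -exprM -[n%:R^-1]lnK ?posrE; last lra.
  by rewrite lnV ?posrE// -expRM_natl ler_expR natrM natrD; lra.
have -> : \sum_(t : bool * ({set V} * {set V}) | t.2.1 != set0)
   k%:R * (y ^+ #|t.2.1| * y ^+ #|t.2.2|) =
   2 * k%:R * (((1 + y) ^+ n - 1) * (1 + y) ^+ n).
  rewrite -(pair_big xpredT (fun t : {set V} * {set V} => t.1 != set0)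
    (fun _ t => k%:R * (y ^+ #|t.1| * y ^+ #|t.2|))) /=.
  rewrite sumr_const card_bool -[LHS]mulr_natl -mulrA; congr (_ * _).
  rewrite -mulr_sumr; congr (_ * _).
  rewrite (eq_bigl (fun t : {set V} * {set V} => (t.1 != set0) && true)); last first.
    by move=> t; rewrite andbT.
  rewrite -(pair_big (fun U : {set V} => U != set0) xpredT
    (fun U (Z : {set V}) => y ^+ #|U| * y ^+ #|Z|)) /=.
  under eq_bigr do rewrite -mulr_sumr.
  rewrite -mulr_suml -!sum_expr_card; congr (_ * _).
  by rewrite [in RHS](bigD1 set0) //= cards0 expr0 addrC addrK.
have ny : n%:R * y = (n%:R^-1) ^+ 11.
  by rewrite /y exprS mulrA divff ?mul1r// lt0r_neq0.
set q := n%:R * y in ny.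
have q0 : 0 <= q by rewrite mulr_ge0// ltW.
have q8 : n%:R ^+ 2 * q <= 1 / 2 ^+ 9.
  have -> : n%:R ^+ 2 * q = n%:R^-1 ^+ 9.
    by rewrite ny -[11%N]/(2 + 9)%N exprD mulrA -exprMn divff ?lt0r_neq0// expr1n mul1r.
  rewrite (_ : 1 / 2 ^+ 9 = (1 / 2) ^+ 9 :> R); last by field.
  by rewrite lerXn2r ?nnegrE//; lra.
have qle : q <= 1 / 2 ^+ 9.
  by apply: le_trans q8; rewrite ler_peMl//; nra.
have := expr1D_le y0 (_ : n%:R * y <= 1 / 2); rewrite -/q => /(_ ltac:(lra)) yn.
have yn1 : 1 <= (1 + y) ^+ n by rewrite exprn_ege1//; lra.
have kn2 : k%:R <= n%:R ^+ 2 :> R by rewrite -natrX ler_nat.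
have k0 : 0 <= k%:R :> R by [].
(* Excluding the empty [U] leaves [(1+y)^n - 1 <= 2q], and the total is at most
   [8 n^2 q <= 1/64]. *)
apply: le_lt_trans (_ : 2 * n%:R ^+ 2 * (2 * q * 2) < _); last by lra.
rewrite ler_pM//; first by rewrite mulr_ge0.
- by rewrite mulr_ge0; lra.
- lra.
by apply: ler_pM; lra.
Qed.

(** * Logarithms and edge counts *)

Lemma ln_le_log2 (R : realType) (x : R) : 1 <= x -> ln x <= log2 x.
Proof.
move=> x1; have ln2 : 0 < ln 2 :> R by rewrite ln_gt0// ltr1n.
rewrite /log2 ler_pdivlMr// ler_piMr ?ln_ge0//.
by have := @le_ln1Dx R 1 ltac:(lra); rewrite -natr1.
Qed.

Lemma log2_ge1 (R : realType) (x : R) : 2 <= x -> 1 <= log2 x.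
Proof.
move=> x2; rewrite /log2 ler_pdivlMr ?mul1r; last by rewrite ln_gt0// ltr1n.
by rewrite ler_ln// posrE; lra.
Qed.

(** Otherwise all edges could be deleted around a single vertex, leaving it without neighbours. This
    serves to bound the number of colours by [n^2]. *)
Lemma expander_edges_gt (R : realType) (V : finType) (eps s : R)
    (G : sgraph V) : 0 < eps -> (1 < #|V|)%N -> expander eps s G ->
  s < #|edges G|%:R.
Proof.
move=> eps0 V1 expG; rewrite ltNge; apply/negP => Gs.
have [v _] := card_gt0P (ltnW V1).
have n2 : 2 <= #|V|%:R :> R by rewrite ler_nat.
have := expG [set v] (edges G); rewrite cards1 !mulr1 => /(_ isT).
move=> /(_ ltac:(lra) (subxx _) Gs).
rewrite (_ : nbhd _ _ = set0); last first.
  apply/setP => u; rewrite in_nbhd in_set0; apply/negP => /andP[_].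
  by case/set0Pn => e; rewrite inE /= setDv inE.
rewrite cards0 leNgt divr_gt0// exprn_gt0//.
by apply: lt_le_trans (log2_ge1 n2).
Qed.

Lemma card_edges_le (V : finType) (G : sgraph V) : (#|edges G| <= #|V| ^ 2)%N.
Proof.
have : edges G \subset [set A : {set V} | A \subset setT & #|A| == 2%N].
  by apply/subsetP => e eG; rewrite inE subsetT (edges_card2 eG).
move/subset_leq_card/leq_trans; apply; rewrite cards_draws cardsT bin2; nia.
Qed.


(** * Colour classes and the decomposition *)

Definition colour_class (V : finType) (G : sgraph V) (k : nat)
    (c : {ffun {set V} -> 'I_k}) (i : 'I_k) : sgraph V :=
  del_edges G [set e | c e != i].

Lemma in_colour_class (V : finType) (G : sgraph V) (k : nat)
    (c : {ffun {set V} -> 'I_k}) (i : 'I_k) e :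
  (e \in edges (colour_class G c i)) = (e \in edges G) && (c e == i).
Proof. by rewrite !inE negbK andbC. Qed.

Lemma colour_class_disjoint (V : finType) (G : sgraph V) (k : nat)
    (c : {ffun {set V} -> 'I_k}) (i j : 'I_k) : i != j ->
  [disjoint edges (colour_class G c i) & edges (colour_class G c j)].
Proof.
move=> ij; apply/pred0P => e /=; rewrite !in_colour_class.
by apply: contraNF ij => /andP[/andP[_ /eqP<-] /andP[_ /eqP<-]].
Qed.

Lemma bigcup_colour_class (V : finType) (G : sgraph V) (k : nat)
    (c : {ffun {set V} -> 'I_k}) :
  edges G = \bigcup_(i < k) edges (colour_class G c i).
Proof.
apply/setP => e; apply/idP/bigcupP => [eG|[i _]]; last first.
  by rewrite in_colour_class => /andP[].
by exists (c e); rewrite // in_colour_class eG eqxx.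
Qed.

Lemma expander_card_le1 (R : realType) (V : finType) (eps s : R)
    (G : sgraph V) : (#|V| <= 1)%N -> expander eps s G.
Proof.
move=> V1 U F U1 UV; exfalso; move: U1 UV; rewrite -(ler_nat R).
move: V1; rewrite -(ler_nat R); lra.
Qed.

Lemma exists_cut_balanced_colouring (R : realType) (V : finType)
    (G : sgraph V) (k : nat) (L : R) :
  (0 < k)%N -> (1 < #|V|)%N -> (k <= #|V| ^ 2)%N -> ln #|V|%:R <= L ->
  exists c : {ffun {set V} -> 'I_k}, forall (i : 'I_k) (U Z X : {set V}),
    U != set0 -> (#|Z| <= #|U|)%N -> X = Z \/ X = ~: U :\: Z ->
    64 * k%:R * #|U|%:R * L <= #|cut_edges G U X|%:R ->
    #|cut_edges G U X|%:R / k%:R <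
      8 * #|cut_edges G U X :&: edges (colour_class G c i)|%:R :> R.
Proof.
move=> k0 V1 kV lnL.
pose A (t : bool * ({set V} * {set V})) :=
  cut_edges G t.2.1 (if t.1 then t.2.2 else ~: t.2.1 :\: t.2.2).
have [c cP] := @exists_balanced_colouring R _ _ _ A _ k0
  (sum_expR_pairs_lt1 (fun t => #|A t|%:R / k%:R) V1 kV).
exists c => i U Z X U0 ZU XZ tX.
have : exists b, X = if b then Z else ~: U :\: Z.
  by case: XZ => ->; [exists true | exists false].
case=> b Xb; have := cP (b, (U, Z)); rewrite /A /= -Xb U0 ZU /= => /(_ _ i).
have -> : [set e in cut_edges G U X | c e == i] =
    cut_edges G U X :&: edges (colour_class G c i).
  apply/setP => e; rewrite in_setI in_colour_class inE andbA.
  by congr (_ && _); rewrite andb_idr //; exact: (subsetP (cut_sub _ _ _)).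
apply; rewrite ler_pdivlMr ?ltr0n//; apply: le_trans tX.
have : 64 * #|U|%:R * ln #|V|%:R * k%:R <= 64 * #|U|%:R * L * k%:R :> R.
  by rewrite ler_wpM2r// ler_wpM2l// mulr_ge0.
lra.
Qed.

Theorem lemma15 (R : realType) (n k s : nat) (eps : R)
    (V : finType) (G : sgraph V) :
  (0 < k)%N ->
  0 < eps -> eps <= 1 ->
  #|V| = n ->
  expander eps s%:R G ->
  s%:R >= 2 ^+ 12 * eps^-1 * k%:R ^+ 2 * log2 (n%:R : R) ^+ 4 ->
  exists H : 'I_k -> sgraph V,
    [/\ forall i j : 'I_k, i != j -> [disjoint edges (H i) & edges (H j)],
        edges G = \bigcup_(i < k) edges (H i)
      & forall i : 'I_k,
          expander (eps / 4)
            (Num.sqrt (s%:R * eps) / (8 * k%:R * log2 (n%:R : R))) (H i)].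
Proof.
move=> k0 eps0 eps1 Vn expG sge.
suff [c cP] : exists c : {ffun {set V} -> 'I_k}, forall i,
    expander (eps / 4) (Num.sqrt (s%:R * eps) / (8 * k%:R * log2 (n%:R : R)))
      (colour_class G c i).
  exists (colour_class G c); split=> //; last exact: bigcup_colour_class.
  by move=> i j; exact: colour_class_disjoint.
have [n1|n1] := leqP n 1%N.
  by exists [ffun=> Ordinal k0] => i; apply: expander_card_le1; rewrite Vn.
set L := log2 _ in sge *.
have n2 : 2 <= n%:R :> R by rewrite ler_nat.
have L1 : 1 <= L by exact: log2_ge1.
have k1 : 1 <= k%:R :> R by rewrite ler1n.
set S := Num.sqrt _.
have SE : S ^+ 2 = s%:R * eps by rewrite sqr_sqrtr// mulr_ge0// ltW.
have S0 : 0 <= S by exact: sqrtr_ge0.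
(* The square root of the hypothesis on [s], with [2^12 = 64^2]. *)
have Sge : 64 * k%:R * L ^+ 2 <= S.
  rewrite -(@ler_pXn2r _ 2)// ?nnegrE//; last first.
    by rewrite mulr_ge0 ?exprn_ge0//; lra.
  rewrite SE; apply: le_trans (ler_wpM2r (ltW eps0) sge).
  by rewrite le_eqVlt; apply/orP; left; apply/eqP; field; rewrite lt0r_neq0.
have S64 : 64 * k%:R * L <= S by apply: le_trans Sge; rewrite ler_wpM2l//; nra.
have Spos : 64 * k%:R <= S by apply: le_trans S64; rewrite ler_peMr//; lra.
have sE : s%:R = S ^+ 2 / eps by rewrite SE mulfK// lt0r_neq0.
have sS : S ^+ 2 <= s%:R by rewrite SE ler_piMr.
(* The chain is [k <= s < #|edges G| <= n^2]. *)
have kV : (k <= #|V| ^ 2)%N.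
  apply: leq_trans (card_edges_le G); rewrite -(ler_nat R).
  apply: le_trans (ltW (expander_edges_gt eps0 _ expG)); last by rewrite Vn.
  nra.
have V1 : (1 < #|V|)%N by rewrite Vn.
have lnL : ln #|V|%:R <= L by rewrite Vn ln_le_log2//; lra.
have [c cP] := exists_cut_balanced_colouring G k0 V1 kV lnL.
exists c => i U F U1 UV _ FU.
rewrite Vn -/L; set u : R := #|U|%:R in UV FU *.
have u1 : 1 <= u by rewrite ler1n.
have U0 : U != set0 by rewrite -card_gt0.
have L0 : L != 0 by apply: lt0r_neq0; lra.
have e0 : eps != 0 by apply: lt0r_neq0.
have kn0 : k%:R != 0 :> R by apply: lt0r_neq0; lra.
have L2 : 1 <= L ^+ 2 by rewrite exprn_ege1.
have Lu : u / L ^+ 2 <= u by rewrite ler_pdivrMr ?ler_peMr//; lra.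
have uL : 0 < u / L ^+ 2 by rewrite divr_gt0//; lra.
have SuL : S * u / L <= S * u by rewrite ler_pdivrMr ?ler_peMr ?mulr_ge0//; lra.
have SuL0 : 0 <= S * u / L by rewrite !mulr_ge0 ?invr_ge0//; lra.
(* The degree threshold is chosen so that [dm] equals [8kf], as [fE] confirms. *)
have dm : 4 * L * S / eps * (eps / 4 * u / L ^+ 2) = S * u / L.
  by field; rewrite e0 L0.
have fE : 8 * k%:R * (S / (8 * k%:R * L) * u) = S * u / L.
  by field; rewrite kn0 L0.
have t_le : 64 * k%:R * u * L <= S * u / L.
  rewrite ler_pdivlMr; last lra.
  have := ler_wpM2r (_ : 0 <= u) Sge => /(_ ltac:(lra)); lra.
(* This gives [8k(dm + f) <= sigma]: here [8k + 1 <= S], [S^2 <= s] and [L >= 1]. *)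
have SSu : (8 * k%:R + 1) * (S * u) <= s%:R * u.
  by rewrite mulrA ler_wpM2r//; nra.
apply: (@subgraph_expands _ _ G _ U F k%:R (s%:R * u) (S / (8 * k%:R * L) * u)
  (4 * L * S / eps) _ (64 * k%:R * u * L)) => //.
- by apply/subsetP => e; rewrite in_colour_class => /andP[].
- move=> F0 F0G F0s; have := expG U F0 U1 UV F0G F0s; rewrite Vn -/L -/u.
  by rewrite (_ : 4 * _ = eps * u / L ^+ 2)//; field.
- by move=> Z ZU; apply: (cP i U Z Z) => //; left.
- by move=> Z ZU; apply: (cP i U Z) => //; right.
- lra.
- by rewrite divr_gt0// mulr_gt0//; lra.
- by rewrite -mulrA mulr_gt0//; lra.
- by rewrite -mulrA; nra.
- by rewrite dm.
- by rewrite dm fE.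
- nra.
rewrite mulrDr fE dm.
nra.
Qed.
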